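(* Let $X$ be a one-dimensional irreducible shift of finite type, $(X,\phi)$ a surjective cellular automaton, and $\mu$ a $\sigma$-ergodic Borel probability measure on $X$ with $\mu(EQ(\phi))=1$. Let $\mu_\infty$ be the weak limit of $\frac1n\sum_{i=1}^n\phi^i\mu$ as $n\to\infty$. Then $\mu_\infty$ is $\sigma$-ergodic if and only if $\mu$ is $\phi$-invariant.
   Context: $\mathcal{A}$ is a finite alphabet. $\mathcal{A}^{\mathbb{Z}}$ has the product topology and the shift $\sigma$, $(\sigma x)_j=x_{j+1}$. A one-dimensional subshift is a closed $\sigma$-invariant set $X\subset\mathcal{A}^{\mathbb{Z}}$; it is a shift of finite type (SFT) if it is the set of all sequences in which no pattern from some finite list of forbidden words appears. It is irreducible if for all nonempty cylinder sets $U,V\subset X$ there is $j\ge1$ with $\sigma^jU\cap V\ne\emptyset$. A cellular automaton (CA) $(X,\phi)$ is a subshift $X$ with a continuous map $\phi:X\to X$ commuting with $\sigma$; it is surjective if $\phi(X)=X$. With $W_m=[-m,m]\cap\mathbb{Z}$, put $B_n(x)=\{y\in X: y_{W_n}=x_{W_n}\}$ and $O_m(x)=\{y\in X: (\phi^i y)_{W_m}=(\phi^i x)_{W_m}\ \forall i\ge0\}$. A point $x\in X$ is an equicontinuity point of $\phi$ if for every $m$ there is $n$ with $B_n(x)\subset O_m(x)$; $EQ(\phi)$ is the set of equicontinuity points. $\phi^i\mu$ is the push-forward of $\mu$ under $\phi^i$. Weak convergence is convergence of integrals of continuous functions; the weak limit $\mu_\infty$ exists under the stated hypotheses. A measure is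 $\sigma$-ergodic if it is $\sigma$-invariant and ergodic for $\sigma$; $\mu$ is $\phi$-invariant if $\phi\mu=\mu$. *)

(* Defs.v *)
From HB Require Import structures.
From mathcomp Require Import all_boot all_order all_algebra.
From mathcomp Require Import all_classical all_reals all_analysis.

Set Implicit Arguments.
Unset Strict Implicit.
Unset Printing Implicit Defensive.

Import Order.TTheory GRing.Theory Num.Theory.
Import numFieldNormedType.Exports.

Local Open Scope classical_set_scope.
Local Open Scope ring_scope.

Definition full_shift (A : finType) : Type :=
  prod_topology (fun _ : int => discrete_topology A).

HB.instance Definition _ (A : finType) :=
  Topological.copy (full_shift A)
    (prod_topology (fun _ : int => discrete_topology A)).

Definition shift_map (A : finType) (x : full_shift A) : full_shift A :=
  fun j => x (j + 1).

(* x_k x_(k+1) ... x_(k+n-1) *)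
Definition word (A : finType) (x : full_shift A) (k : int) (n : nat) : seq A :=
  mkseq (fun i => x (k + i%:Z)) n.

(* Measurable types are pointed in MathComp-Analysis, hence the nonemptiness
   field; a subshift that carries a probability measure satisfies it anyway. *)
Record subshift (A : finType) := Subshift {
  subshift_set : set (full_shift A);
  subshift_closed : closed subshift_set;
  subshift_invariant : @shift_map A @` subshift_set = subshift_set;
  subshift_nonempty : subshift_set !=set0 }.

Definition points (A : finType) (X : subshift A) : Type :=
  set_type (subshift_set X).

Coercion points : subshift >-> Sortclass.

Section points_structures.
Context (A : finType) (X : subshift A).

HB.instance Definition _ :=
  Topological.copy (points X) (set_type (subshift_set X)).

Definition base_point : X :=
  exist _ (sval (cid (subshift_nonempty X)))
    (mem_set (svalP (cid (subshift_nonempty X)))).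

HB.instance Definition _ := isPointed.Build (points X) base_point.

(* the Borel sigma-algebra of the subspace topology *)
HB.instance Definition _ :=
  Measurable.copy (points X) (g_sigma_algebraType (@open X)).

Definition val_point (x : X) : full_shift A := set_val x.

Lemma shift_point_subproof (x : X) : shift_map (val_point x) \in subshift_set X.
Proof.
apply/mem_set; rewrite -(subshift_invariant X); exists (val_point x) => //.
exact: set_valP.
Qed.

Definition shift_point (x : X) : X :=
  exist _ (shift_map (val_point x)) (shift_point_subproof x).

Definition cylinder (k : int) (w : seq A) : set X :=
  [set x | word (val_point x) k (size w) = w].

End points_structures.

Arguments shift_point {A X} x.
Arguments cylinder {A} X k w.

Definition is_sft (A : finType) (X : subshift A) : Prop :=
  exists F : seq (seq A), subshift_set X =
    [set x | forall w, w \in F -> forall k : int, word x k (size w) <> w].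

Definition irreducible (A : finType) (X : subshift A) : Prop :=
  forall (k l : int) (u v : seq A),
    cylinder X k u !=set0 -> cylinder X l v !=set0 ->
    exists2 j : nat, (1 <= j)%N &
      (iter j shift_point @` cylinder X k u) `&` cylinder X l v !=set0.

Record cellular_automaton (A : finType) (X : subshift A) :=
  CellularAutomaton {
    ca_fun :> X -> X;
    ca_continuous : continuous ca_fun;
    ca_shift : forall x, ca_fun (shift_point x) = shift_point (ca_fun x) }.

Arguments ca_continuous {A X} c x.

Section equicontinuity.
Context (A : finType) (X : subshift A) (phi : cellular_automaton X).

Definition agree_on_window (m : nat) (x y : X) : Prop :=
  forall j : int, `|j| <= m%:Z -> val_point y j = val_point x j.

Definition Bset (n : nat) (x : X) : set X := [set y | agree_on_window n x y].

Definition Oset (m : nat) (x : X) : set X :=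
  [set y | forall i : nat, agree_on_window m (iter i phi x) (iter i phi y)].

Definition equicontinuity_points : set X :=
  [set x | forall m : nat, exists n : nat, Bset n x `<=` Oset m x].

End equicontinuity.

Section measures.
Context (R : realType) (A : finType) (X : subshift A).

Definition measure_invariant (f : X -> X) (mu : probability X R) : Prop :=
  forall B : set X, measurable B -> pushforward mu f B = mu B.

Definition shift_ergodic (mu : probability X R) : Prop :=
  measure_invariant shift_point mu /\
  forall B : set X, measurable B -> shift_point @^-1` B = B ->
    mu B = 0%E \/ mu B = 1%E.

Lemma iter_ca_continuous (phi : cellular_automaton X) (i : nat) :
  continuous (iter i phi).
Proof.
elim: i => [|i IH] x; first exact: cvg_id.
exact: (@continuous_comp _ _ _ (iter i phi) phi _ (IH x)
  (ca_continuous phi _)).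
Qed.

Lemma iter_ca_measurable (phi : cellular_automaton X) (i : nat) :
  measurable_fun [set: X] (iter i phi).
Proof.
apply: (@measurability _ _ X X _ _ (@open X)) => // _ [B oB <-].
rewrite setTI; apply: sub_sigma_algebra.
by apply: open_comp => // x _; exact: iter_ca_continuous.
Qed.

Definition ca_iter (phi : cellular_automaton X) (i : nat) : X -> X := iter i phi.

HB.instance Definition _ (phi : cellular_automaton X) (i : nat) :=
  isMeasurableFun.Build _ _ X X (ca_iter phi i) (iter_ca_measurable phi i).

(* (1/n) (phi mu + ... + phi^n mu) *)
Definition cesaro_mean (phi : cellular_automaton X) (mu : probability X R)
    (n : nat) : {measure set X -> \bar R} :=
  mscale (n%:R^-1)%:nng (msum (fun i => distribution mu (ca_iter phi i.+1)) n).

Definition weak_limit (nu_ : nat -> {measure set X -> \bar R})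
    (nu : {measure set X -> \bar R}) : Prop :=
  forall f : X -> R, continuous f ->
    (\int[nu_ n]_x (f x)%:E)%E @[n --> \oo] --> (\int[nu]_x (f x)%:E)%E.

End measures.

Arguments measure_invariant {R A X} f mu.
Arguments shift_ergodic {R A X} mu.

(* Main.v *)
Require Import Defs.
From HB Require Import structures.
From mathcomp Require Import all_boot all_order all_algebra.
From mathcomp Require Import all_classical all_reals all_analysis.
From mathcomp Require Import measurable_realfun zify ring lra.

(* Let x be an equicontinuity point and W a window. All points close to x have
   the same window orbit under phi, and some of them return close to x, because
   a surjective cellular automaton on an irreducible SFT has no wandering
   cylinder: otherwise every orbit would visit points in which the cylinder
   occurs with small frequency, so that, up to bounded data, every word of X
   would be the image of such a poor word, whereas poor words are exponentially
   rare. Hence (phi^i x)_W is periodic in i.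

   For p = N! with N large, the Cesaro means of phi^(pi) mu therefore stay close
   to mu on window sets. They are also at most p times Cesaro means of
   phi^i mu, hence asymptotically at most p mu_oo, and they are shift
   invariant; since shift averages of a window function converge to a
   constant in L^1(mu_oo) when mu_oo is ergodic, these means tend to mu_oo. So
   ergodicity of mu_oo forces mu = mu_oo, which is phi-invariant. *)

Set Implicit Arguments.
Unset Strict Implicit.
Unset Printing Implicit Defensive.

Import Order.TTheory GRing.Theory Num.Theory.
Import numFieldNormedType.Exports.

Local Open Scope classical_set_scope.
Local Open Scope ring_scope.

(** * Words with few good blocks *)

Section block_counting.
Context (B : finType) (good : pred B) (M : nat).
Implicit Types (w : {ffun 'I_M -> B}) (W : {set {ffun 'I_M -> B}}) (R : realFieldType).

Definition update w (i : 'I_M) (b : B) : {ffun 'I_M -> B} :=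
  [ffun j => if j == i then b else w j].

(** Halving the weight at every good block, instead of counting good blocks, lets the total over [W]
    be bounded one block at a time. *)
Let h R (b : B) : R := if good b then 2^-1 else 1.

Let h_ge0 R (b : B) : 0 <= h R b.
Proof. by rewrite /h; case: ifP => _; rewrite ?invr_ge0 ?ler0n. Qed.

Let weight R (n : nat) w : R := \prod_(i < M | (i < n)%N) h R (w i).

Let weight_ge0 R n w : 0 <= weight R n w.
Proof. by apply: prodr_ge0 => i _; exact: h_ge0. Qed.

Let weight_update R (i : 'I_M) w b : weight R i (update w i b) = weight R i w.
Proof.
apply: eq_bigr => j ji; rewrite /update ffunE; case: eqP ji => // ->.
by rewrite ltnn.
Qed.

Let weightS R (i : 'I_M) w : weight R i.+1 w = h R (w i) * weight R i w.
Proof.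
rewrite /weight (bigD1 i) //=; congr (_ * _); apply: eq_bigl => j.
by rewrite ltnS ltn_neqAle andbC.
Qed.

(* The map sending [w] to its improvement at block [i] has fibres of size at
   most [#|B|], since [w] is recovered from its image and from [w i]. *)
Let weight_step R W (i : 'I_M) :
  (forall w, w \in W -> exists2 b, good b & update w i b \in W) ->
  \sum_(w in W) weight R i.+1 w <=
    (1 - (2 * #|B|%:R)^-1) * \sum_(w in W) weight R i w.
Proof.
move=> HW.
have [W0|[w0 w0W]] : W = finset.set0 \/ exists w, w \in W.
  by case: (set_0Vmem W) => [|[w ww]]; [left|right; exists w].
  by rewrite W0 !big_set0 mulr0.
have B0 : (0 < #|B|)%N by apply/card_gt0P; exists (w0 i).
pose f w := if [pick b | good b && (update w i b \in W)] is Some b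
            then update w i b else w.
have fP w : w \in W -> [/\ f w \in W, good (f w i), weight R i (f w) = weight R i w
    & update (f w) i (w i) = w].
  move=> /HW [b gb bW]; rewrite /f; case: pickP => [c /andP[gc cW]|/(_ b)]; last by rewrite gb bW.
  split => //; rewrite ?weight_update//; first by rewrite /update ffunE eqxx.
  by apply/ffunP => j; rewrite !ffunE; case: eqP => // ->.
have key : \sum_(w in W) weight R i w <=
    #|B|%:R * \sum_(v in W | good (v i)) weight R i v.
  rewrite (partition_big f (fun v => (v \in W) && good (v i))) /=; last first.
    by move=> w /fP[-> ->].
  rewrite mulr_sumr ler_sum // => v _.
  rewrite (eq_bigr (fun=> weight R i v)); last by move=> w /andP[/fP[_ _ <- _] /eqP ->].
  rewrite sumr_const -[leLHS]mulr_natl; apply: ler_wpM2r; first exact: weight_ge0.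
  rewrite ler_nat.
  rewrite -(@card_in_imset _ _ (fun w => w i)) ?max_card//.
  move=> w w' /= /andP[/fP[_ _ _ e] /eqP fw] /andP[/fP[_ _ _ e'] /eqP fw'] ww'.
  by rewrite -e -e' fw fw' ww'.
have -> : \sum_(w in W) weight R i.+1 w =
    \sum_(w in W) weight R i w - 2^-1 * \sum_(v in W | good (v i)) weight R i v.
  rewrite mulr_sumr big_mkcondr -sumrB; apply: eq_bigr => w _.
  by rewrite weightS /h; case: ifP => _; field.
rewrite mulrBl mul1r lerD2l lerN2 invfM -mulrA ler_wpM2l ?invr_ge0//.
by rewrite ler_pdivrMl ?ltr0n.
Qed.

(** Over [M] blocks the total weight decays geometrically, while a word with at most [k] good blocks
    keeps weight at least [2^-k]. *)
Lemma few_good_blocks R W (k : nat) :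
  (forall w i, w \in W -> exists2 b, good b & update w i b \in W) ->
  (#|[set w in W | (#|[pred i | good (w i)]| <= k)%N]|)%:R <=
    2 ^+ k * (1 - (2 * #|B|%:R)^-1) ^+ M * #|W|%:R :> R.
Proof.
move=> HW.
have step n : (n <= M)%N ->
    \sum_(w in W) weight R n w <= (1 - (2 * #|B|%:R)^-1) ^+ n * #|W|%:R.
  elim: n => [_|n IH nM].
    rewrite expr0 mul1r (eq_bigr (fun=> 1)) ?sumr_const// => w _.
    by rewrite /weight big_pred0.
  apply: le_trans (@weight_step R W (Ordinal nM) _) _; first by move=> w /HW.
  rewrite exprS -mulrA; apply: ler_wpM2l; last exact: IH (ltnW nM).
  (* For empty [B] the inverse of 0 is 0, so the factor is 1. *)
  case: (posnP #|B|) => [->|B0]; first by rewrite mulr0 invr0 subr0.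
  rewrite subr_ge0 invf_le1 ?mulr_gt0 ?ltr0n//.
  by rewrite -natrM ler1n muln_gt0.
have wM w : weight R M w = 2^-1 ^+ #|[pred i | good (w i)]|.
  rewrite /weight (eq_bigl xpredT); last by move=> i; rewrite ltn_ord.
  rewrite /h -big_mkcond /= prodr_const; congr (_ ^+ _).
rewrite -mulrA -ler_pdivrMl ?exprn_gt0//.
apply: le_trans (step M (leqnn M)).
rewrite -exprVn mulr_natr -sumr_const.
apply: le_trans (_ : \sum_(w in [set w in W | (#|[pred i | good (w i)]| <= k)%N]) weight R M w <= _).
  apply: ler_sum => w; rewrite inE => /andP[_ kw].
  by rewrite wM ler_wiXn2l// ?invr_ge0// invf_le1// ler1n.
rewrite [leRHS](bigID (fun w => (#|[pred i | good (w i)]| <= k)%N)) /=.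
rewrite (eq_bigl (fun w => (w \in W) && (#|[pred i | good (w i)]| <= k)%N)); last by move=> w; rewrite inE.
by rewrite lerDl sumr_ge0 // => w _; exact: weight_ge0.
Qed.

End block_counting.

(** * Gluing and insertion in shifts of finite type *)

Section words.
Context (A : finType).
Implicit Types (x y : full_shift A) (u : seq A).

Lemma word_eq x y (k l : int) n :
  word x k n = word y l n <-> forall i, (i < n)%N -> x (k + i%:Z) = y (l + i%:Z).
Proof.
split=> [e i iN|e].
  by have := congr1 (fun s => nth (x 0) s i) e; rewrite !nth_mkseq.
by apply: (@eq_from_nth _ (x 0)); rewrite ?size_mkseq// => i iN; rewrite !nth_mkseq// e.
Qed.

Lemma val_iter_shift (X : subshift A) n (x : X) j :
  val_point (iter n shift_point x) j = val_point x (j + n%:Z).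
Proof.
elim: n j => [|n IH] j; first by rewrite addr0.
rewrite iterS; transitivity (val_point (iter n shift_point x) (j + 1)) => //; rewrite IH.
by congr (val_point x _); lia.
Qed.

End words.

Section gluing.
Context (A : finType) (X : subshift A).
Implicit Types (x y z : full_shift A) (u : seq A).

(** The Markov property with memory [s]; finite type enters the later proofs through it. *)
Definition glues (s : nat) := forall x y (k : int),
  subshift_set X x -> subshift_set X y ->
  (forall j, k <= j < k + s%:Z -> x j = y j) ->
  subshift_set X (fun j => if j < k then x j else y j).

(** Take for [s] the largest length of a forbidden word. A word starting left of [k] ends before
    [k + s], where the spliced sequence still equals [x]; a word starting at or after [k] lies in
    [y]. *)
Lemma sft_glues : is_sft X -> exists s, glues s.
Proof.
move=> [F XF]; exists (\max_(w <- F) size w)%N => x y k Xx Xy xy.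
rewrite XF => w wF l /=.
have sw : (size w <= \max_(w <- F) size w)%N.
  by apply: (@leq_bigmax_seq _ _ xpredT size).
have [lk|kl] := ltP l k.
- have := Xx; rewrite {1}XF => /(_ w wF l); apply: contra_not => e; rewrite -{2}e; apply/word_eq => i iw.
  case: ifP => // ik; apply: xy; lia.
- have := Xy; rewrite {1}XF => /(_ w wF l); apply: contra_not => e; rewrite -{2}e; apply/word_eq => i iw.
  case: ifP => // ik; lia.
Qed.

Lemma shift_closed x (k : int) :
  subshift_set X x -> subshift_set X (fun j => x (j + k)).
Proof.
have right y (n : nat) : subshift_set X y -> subshift_set X (fun j => y (j + n%:Z)).
  elim: n => [|n IH] Xy.
    by have -> : (fun j => y (j + 0%N%:Z)) = y by apply/funext => j; rewrite addr0.
  rewrite -(subshift_invariant X); exists (fun j => y (j + n%:Z)); first exact: IH.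
  by apply/funext => j; rewrite /shift_map; congr (y _); lia.
have left y (n : nat) : subshift_set X y -> subshift_set X (fun j => y (j - n%:Z)).
  elim: n => [|n IH] Xy.
    by have -> : (fun j => y (j - 0%N%:Z)) = y by apply/funext => j; rewrite subr0.
  have := IH Xy; rewrite -{1}(subshift_invariant X) => -[z Xz zy].
  have -> : (fun j => y (j - n.+1%:Z)) = z => //.
  apply/funext => j; have := congr1 (fun f => f (j - 1)) zy; rewrite /shift_map subrK => ->.
  by congr (y _); lia.
case: k => n; first exact: right.
by rewrite NegzE => /(left _ n.+1).
Qed.

Lemma glue s x y (k : int) : glues s -> subshift_set X x -> subshift_set X y ->
  (forall i, (i < s)%N -> x (k + i%:Z) = y i%:Z) ->
  subshift_set X (fun j => if j < k then x j else y (j - k)).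
Proof.
move=> gs Xx Xy xy; apply: (gs x (fun j => y (j - k))) => //; first exact: shift_closed.
move=> j kj; have -> : j = k + `|j - k|%N by lia.
by rewrite xy; [congr y; lia|lia].
Qed.

Section insertion.
Context (s : nat) (u : seq A).
Hypotheses (gs : glues s) (irrX : irreducible X) (su : (s <= size u)%N)
  (uX : exists2 x, subshift_set X x & word x 0 (size u) = u).

(** A cycle through [u] in the graph whose states are blocks of [s] letters. The occurrence of [u]
    may run into the closing copy of [a], whence the bound [l + s]. *)
Definition loop (a : {ffun 'I_s -> A}) (l : nat) := exists z,
  [/\ subshift_set X z, forall i : 'I_s, z (i : nat)%:Z = a i,
      forall i : 'I_s, z (l%:Z + (i : nat)%:Z) = a i &
      exists2 c : nat, (c + size u <= l + s)%N & word z c%:Z (size u) = u].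

Lemma loop_add a l1 l2 : loop a l1 -> loop a l2 -> loop a (l1 + l2)%N.
Proof.
move=> [z1 [X1 z1a z1b [c cl cu]]] [z2 [X2 z2a z2b _]].
have agree i : (i < s)%N -> z1 (l1%:Z + i%:Z) = z2 i%:Z.
  by move=> si; rewrite (z1b (Ordinal si)) (z2a (Ordinal si)).
(* The spliced sequence follows [z1] on the overlap too, so the occurrence of [u] in [z1] survives
   whole. *)
have agree' j : j < l1%:Z + s%:Z ->
    (if j < l1%:Z then z1 j else z2 (j - l1%:Z)) = z1 j.
  move=> jl; case: ltP => // lj; have -> : j = l1%:Z + `|j - l1%:Z|%N by lia.
  rewrite agree; last by lia.
  by congr z2; lia.
exists (fun j => if j < l1%:Z then z1 j else z2 (j - l1%:Z)); split.
- exact: glue gs X1 X2 agree.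
- by move=> i; rewrite agree' ?z1a//; have := ltn_ord i; lia.
- move=> i; have -> : ((l1 + l2)%N%:Z + (i : nat)%:Z < l1%:Z) = false by lia.
  by rewrite -(z2b i); congr z2; lia.
- exists c; first lia.
  rewrite -{2}cu; apply/word_eq => i iu; apply: agree'; lia.
Qed.

Lemma loop_mul a l m : (0 < m)%N -> loop a l -> loop a (m * l)%N.
Proof.
case: m => // m _ al; elim: m => [|m IH]; first by rewrite mul1n.
by rewrite mulSn; apply: loop_add.
Qed.

(** Irreducibility leads from the state to [u] and from [u] back to the state. The second target
    sits at coordinate [size u], so that it starts after [u] has ended. The two pieces are spliced
    along [u], which has at least [s] letters. *)
Lemma loop_exists x : subshift_set X x ->
  exists2 l, (0 < l)%N & loop [ffun i : 'I_s => x (i : nat)%:Z] l.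
Proof.
move=> Xx; have [y Xy yu] := uX.
have pt z : subshift_set X z -> exists p : X, val_point p = z.
  by move=> Xz; exists (exist _ z (mem_set Xz)).
have [px pxE] := pt _ Xx.
have [py pyE] := pt _ Xy.
have [px' px'E] := pt _ (shift_closed (- (size u)%:Z) Xx).
have [||j1 j1_gt0 [_ [[z1 z1x <-]]]] := irrX (k := 0) (l := 0) (u := word x 0 s) (v := u).
- by exists px; rewrite /cylinder /= size_mkseq pxE.
- by exists py; rewrite /cylinder /= pyE.
rewrite /cylinder /= => z1u.
have [||j2 j2_gt0 [_ [[z2 z2u <-]]]] := irrX (k := 0) (l := (size u)%:Z) (u := u) (v := word x 0 s).
- by exists py; rewrite /cylinder /= pyE.
- exists px'; rewrite /cylinder /= size_mkseq px'E; apply/word_eq => i si.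
  by congr x; lia.
move: z1x z2u; rewrite /cylinder /= size_mkseq => z1x z2u z2x.
have agree i : (i < size u)%N -> val_point z1 (j1%:Z + i%:Z) = val_point z2 i%:Z.
  move=> iu; move: z1u; rewrite -{2}z2u => /word_eq/(_ i iu).
  by rewrite val_iter_shift !add0r addrC.
have agree' j : j < j1%:Z + (size u)%:Z ->
    (if j < j1%:Z then val_point z1 j else val_point z2 (j - j1%:Z)) = val_point z1 j.
  move=> jl; case: ltP => // lj; have -> : j = j1%:Z + `|j - j1%:Z|%N by lia.
  rewrite agree; last by lia.
  by congr (val_point z2); lia.
exists (j1 + size u + j2)%N; first lia.
exists (fun j => if j < j1%:Z then val_point z1 j else val_point z2 (j - j1%:Z)); split.
- by apply: glue gs (set_valP z1) (set_valP z2) _ => i si; apply: agree; lia.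
- move=> i; have si := ltn_ord i; rewrite agree'; last lia.
  by rewrite ffunE; move/word_eq: z1x => /(_ i si); rewrite !add0r.
- move=> i; have si := ltn_ord i.
  have -> : ((j1 + size u + j2)%N%:Z + (i : nat)%:Z < j1%:Z) = false by lia.
  rewrite ffunE; move/word_eq: z2x => /(_ i si); rewrite val_iter_shift add0r => <-.
  by congr (val_point z2); lia.
- exists j1; first lia.
  rewrite -{2}z1u; apply/word_eq => i iu.
  by rewrite agree' ?val_iter_shift; [congr (val_point z1); lia|lia].
Qed.

(* Among [#states + 1] positions spaced by a common loop length two carry the
   same state, and the stretch between them can be replaced by a loop that
   passes through [u]. *)
Lemma insertion : exists K : nat, forall x, subshift_set X x ->
  exists2 y, subshift_set X y &
    (forall j : int, (j < 0) || (K%:Z <= j) -> y j = x j) /\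
    exists2 c : nat, (c + size u <= K)%N & word y c%:Z (size u) = u.
Proof.
have /choice[l lP] : forall a : {ffun 'I_s -> A}, exists l : nat, (0 < l)%N /\
    forall x, subshift_set X x -> [ffun i : 'I_s => x (i : nat)%:Z] = a -> loop a l.
  move=> a; have [[x Xx <-]|na] := pselect (exists2 x, subshift_set X x &
      [ffun i : 'I_s => x (i : nat)%:Z] = a).
    by have [l l0 ll] := loop_exists Xx; exists l.
  (* States that do not occur in [X] get length 1, which keeps the product [L] positive. *)
  by exists 1%N; split => // x Xx xa; case: na; exists x.
pose L := (\prod_a l a)%N.
pose S := #|{ffun 'I_s -> A}|.
have L_loop a m x : subshift_set X x -> [ffun i : 'I_s => x (i : nat)%:Z] = a ->
    (0 < m)%N -> loop a (m * L)%N.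
  move=> Xx xa m0; rewrite /L (bigD1 a) //= mulnCA mulnC; apply: loop_mul.
    by rewrite muln_gt0 m0 prodn_gt0// => b; case: (lP b).
  by case: (lP a) => _; apply; eassumption.
exists (S * L + s)%N => x Xx.
pose st (i : 'I_S.+1) : {ffun 'I_s -> A} := [ffun k : 'I_s => x ((i * L)%N%:Z + (k : nat)%:Z)].
have [i [j ij stij]] : exists i : 'I_S.+1, exists2 j : 'I_S.+1, (i < j)%N & st i = st j.
  have : ~ injective st by move/leq_card; rewrite card_ord ltnn.
  apply: contra_notP => nex i j stij; apply/val_inj => /=.
  by case: (ltngtP i j) => // ij; case: nex; [exists i, j|exists j, i].
have jS : (j <= S)%N by have := ltn_ord j; lia.
have Xi := shift_closed (i * L)%N%:Z Xx.
have xi : [ffun k : 'I_s => x ((k : nat)%:Z + (i * L)%N%:Z)] = st i.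
  by apply/ffunP => k; rewrite !ffunE addrC.
have ij0 : (0 < j - i)%N by rewrite subn_gt0.
have [z [Xz za zb [c cl cu]]] := L_loop (st i) (j - i)%N _ Xi xi ij0.
have Lij : (i * L + (j - i) * L = j * L)%N by rewrite -mulnDl subnKC// ltnW.
have iLj : (i * L <= j * L)%N by rewrite leq_mul2r (ltnW ij) orbT.
have jSL : (j * L <= S * L)%N by rewrite leq_mul2r jS orbT.
have agree1 k : (k < s)%N -> x ((i * L)%N%:Z + k%:Z) = z k%:Z.
  by move=> ks; rewrite (za (Ordinal ks)) ffunE.
pose y1 := fun k => if k < (i * L)%N%:Z then x k else z (k - (i * L)%N%:Z).
have Xy1 : subshift_set X y1 by exact: glue gs Xx Xz agree1.
have agree2 (k : int) : (j * L)%N%:Z <= k < (j * L)%N%:Z + s%:Z -> y1 k = x k.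
  move=> kj; rewrite /y1; case: ltP => [|_]; first by clear Lij; lia.
  have ks : (`|k - (j * L)%N%:Z| < s)%N by lia.
  have := zb (Ordinal ks); rewrite /= stij ffunE /= => zx.
  transitivity (x ((j * L)%N%:Z + `|k - (j * L)%N%:Z|%N)); last by congr x; lia.
  by rewrite -zx; congr z; lia.
exists (fun k => if k < (j * L)%N%:Z then y1 k else x k); first exact: gs.
split=> [k kK|].
  case: ltP => // kj; rewrite /y1; case: ltP => // ik; lia.
exists (i * L + c)%N; first lia.
rewrite -{2}cu; apply/word_eq => k ku.
have y1z : y1 ((i * L + c)%N%:Z + k%:Z) = z (c%:Z + k%:Z).
  rewrite /y1; case: ltP => [|_]; first lia.
  by congr z; lia.
(* [u] may run past [j * L], but by at most [s] sites, where [y1] and [x] agree. *)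
case: ltP => // jk; rewrite -y1z agree2//; lia.
Qed.

End insertion.
End gluing.

(** * Cylinder topology *)

Section window_topology.
Context (A : finType).

Lemma coordinate_nbhs (p : full_shift A) (j : int) :
  nbhs p [set y : full_shift A | y j = p j].
Proof.
have := @proj_continuous int (fun=> discrete_topology A) j p [set p j].
by apply; exact: discrete_set1.
Qed.

Lemma window_nbhs_full (p : full_shift A) n :
  nbhs p [set y : full_shift A | forall j : int, `|j| <= n%:Z -> y j = p j].
Proof.
elim: n => [|n IH].
  apply: filterS (coordinate_nbhs p 0) => y /= y0 j j0.
  by have -> : j = 0 by lia.
apply: filterS (filterI IH (filterI (coordinate_nbhs p n.+1%:Z) (coordinate_nbhs p (- n.+1%:Z)))).
move=> y /= [yn [yp ym]] j jn.
have [jn'|] := boolP (`|j| <= n%:Z); first exact: yn.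
move=> jn'; have [->//|->//] : j = n.+1%:Z \/ j = - n.+1%:Z by lia.
Qed.

Context (X : subshift A).
Implicit Types (x y z : X).

Lemma agree_refl n x : agree_on_window n x x. Proof. by []. Qed.

Lemma agree_sym n x y : agree_on_window n x y -> agree_on_window n y x.
Proof. by move=> xy j /xy. Qed.

Lemma agree_trans n y x z :
  agree_on_window n x y -> agree_on_window n y z -> agree_on_window n x z.
Proof. by move=> xy yz j jn; rewrite yz// xy. Qed.

Lemma agree_le m n x y : (m <= n)%N ->
  agree_on_window n x y -> agree_on_window m x y.
Proof. by move=> mn xy j jm; apply: xy; lia. Qed.

Lemma val_point_continuous : continuous (@val_point A X).
Proof. exact: initial_continuous. Qed.

Lemma Bset_nbhs x n : nbhs x (Bset n x).
Proof. exact: val_point_continuous (window_nbhs_full (val_point x) n). Qed.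

Lemma nbhs_Bset x (U : set X) : nbhs x U -> exists n, Bset n x `<=` U.
Proof.
move=> xU; apply: contrapT => nex.
have /choice[y yP] : forall n, exists y, Bset n x y /\ ~ U y.
  move=> n; apply: contrapT => ny; apply: nex; exists n => y xy.
  by apply: contrapT => Uy; apply: ny; exists y.
have yx : (fun n => val_point (y n)) @ \oo --> val_point x.
  apply/cvg_sup => j V [W] [[Z oZ <-]] xZ ZV.
  apply: (filterS ZV); exists `|j|%N => // n /= jn.
  by case: (yP n) => /(_ j) -> //; lia.
have {xU} [_ [[V oV <-] /= Vx VU]] := xU.
have [N _ yV] := yx _ (open_nbhs_nbhs (conj oV Vx)).
have [_ []] := yP N; apply: VU; exact: yV (leqnn N).
Qed.

(** Compactness: if pairs agreeing on ever larger windows had different values, [f] would fail to be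
    locally constant at a cluster point of their first components. *)
Lemma locally_constant_uniform (T : Type) (f : X -> T) :
  (forall x, exists n, forall y, agree_on_window n x y -> f y = f x) ->
  exists n, forall y z, agree_on_window n y z -> f y = f z.
Proof.
move=> lf; apply: contrapT => nex.
have /choice[yz yzP] : forall n, exists yz : X * X,
    agree_on_window n yz.1 yz.2 /\ f yz.1 <> f yz.2.
  move=> n; apply: contrapT => ny; apply: nex; exists n => y z yz.
  by apply: contrapT => fyz; apply: ny; exists (y, z).
have cX : compact (subshift_set X).
  apply: (@subclosed_compact _ _ setT); first exact: subshift_closed.
    have := @tychonoff int (fun=> discrete_topology A) (fun=> setT)
      (fun=> @finite_compact (discrete_topology A) setT (@finite_finset A setT)).
    by congr (compact _); apply/seteqP; split.
  by [].
pose F := (fun n => val_point (yz n).1) @ \oo.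
have FX : F (subshift_set X) by exists 0%N => // n _; exact: set_valP.
have [p [Xp Fp]] := cX F _ FX.
pose x : X := exist _ p (mem_set Xp).
have [n fn] := lf x.
have [] := Fp [set val_point (yz m).1 | m in [set m | (n <= m)%N]] _ _ (window_nbhs_full p n).
  by exists n => // m nm; exists m.
move=> _ [[m nm <-] xy].
have [yzm []] := yzP m.
have xy' : agree_on_window n x (yz m).1 by exact: xy.
rewrite (fn (yz m).1) // (fn (yz m).2) //.
exact: agree_trans xy' (agree_le nm yzm).
Qed.

Lemma iter_ca_shift (phi : cellular_automaton X) i n x :
  iter i phi (iter n shift_point x) = iter n shift_point (iter i phi x).
Proof.
have phi_n k z : phi (iter k shift_point z) = iter k shift_point (phi z).
  by elim: k => //= k <-; rewrite ca_shift.
by elim: i => //= i ->.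
Qed.

(** The Curtis-Hedlund-Lyndon theorem for the iterates: coordinate 0 of the image is locally
    constant, hence uniformly so, and commutation with the shift moves this to the site [k]. *)
Lemma iter_ca_radius (phi : cellular_automaton X) i : exists r : nat,
  forall y z (k : nat),
    (forall j : int, `|j| <= r%:Z -> val_point y (k%:Z + j) = val_point z (k%:Z + j)) ->
    val_point (iter i phi y) k%:Z = val_point (iter i phi z) k%:Z.
Proof.
have [x|r rP] := @locally_constant_uniform _ (fun x => val_point (iter i phi x) 0).
  have [n nP] := nbhs_Bset (@iter_ca_continuous _ _ phi i x _ (Bset_nbhs (iter i phi x) 0)).
  by exists n => y /nP; apply.
exists r => y z k yz.
rewrite -[k%:Z]add0r -!val_iter_shift -!iter_ca_shift; apply: rP => j jr.
by rewrite !val_iter_shift addrC yz.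
Qed.

End window_topology.

(** * Nonwandering cylinders *)

Section nonwandering.
Context (A : finType) (X : subshift A) (phi : cellular_automaton X).
Context (s : nat) (u : seq A).
Hypotheses (gs : glues X s) (irrX : irreducible X) (su : (s <= size u)%N)
  (uX : exists2 x, subshift_set X x & word x 0 (size u) = u)
  (surj_phi : range phi = [set: X]).

Let blocks (K M : nat) (x : full_shift A) : {ffun 'I_M -> {ffun 'I_K -> A}} :=
  [ffun i : 'I_M => [ffun c : 'I_K => x (i * K + c)%N%:Z]].

(* [b] contains [u], read off any sequence that extends [b]. *)
Let good (K : nat) (b : {ffun 'I_K -> A}) : bool :=
  `[< forall y : full_shift A, (forall c : 'I_K, y (c : nat)%:Z = b c) ->
      exists2 c : nat, (c + size u <= K)%N & word y c%:Z (size u) = u >].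

Let good_blocks K M (x : full_shift A) (i : 'I_M) : good (blocks K M x i) ->
  exists2 c : nat, (c + size u <= K)%N & word x (i * K + c)%N%:Z (size u) = u.
Proof.
move/asboolP => /(_ (fun j => x (j + (i * K)%N%:Z))) [c|c cK cu].
  by rewrite !ffunE; congr x; lia.
by exists c => //; rewrite -{2}cu; apply/word_eq => k _; congr x; lia.
Qed.

Let eq_blocks K M (x y : full_shift A) :
  (forall k : nat, (k < M * K)%N -> x k%:Z = y k%:Z) -> blocks K M x = blocks K M y.
Proof.
move=> xy; apply/ffunP => i; apply/ffunP => c; rewrite !ffunE; apply: xy.
have : (i.+1 * K <= M * K)%N by rewrite leq_mul2r ltn_ord orbT.
by have := ltn_ord c; rewrite mulSn; lia.
Qed.

Let blocks_eq K M (x y : full_shift A) : blocks K M x = blocks K M y ->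
  forall k : nat, (k < M * K)%N -> x k%:Z = y k%:Z.
Proof.
move=> xy k kMK; have K0 : (0 < K)%N by case: K kMK {xy} => //; rewrite muln0.
have iM : (k %/ K < M)%N by rewrite ltn_divLR.
have cK : (k %% K < K)%N by rewrite ltn_mod.
have /ffunP/(_ (Ordinal iM))/[!ffunE]/ffunP/(_ (Ordinal cK)) := xy.
by rewrite !ffunE /= -divn_eq.
Qed.

Let admissible K M : {set {ffun 'I_M -> {ffun 'I_K -> A}}} :=
  [set w | `[< exists2 x, subshift_set X x & blocks K M x = w >]]%SET.

(** Shift block [i] to the origin, insert [u] there and shift back; the insertion changes no site
    outside that block. *)
Let admissible_update : exists K : nat, forall M w (i : 'I_M),
  w \in admissible K M -> exists2 b, good b & update w i b \in admissible K M.
Proof.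
have [K KP] := insertion gs irrX su uX; exists K => M w i.
rewrite inE => /asboolP[x Xx <-].
have [y Xy [yx [c cK cu]]] := KP _ (shift_closed (i * K)%N%:Z Xx).
exists [ffun c : 'I_K => y (c : nat)%:Z].
  apply/asboolP => z zy; exists c => //; rewrite -{2}cu; apply/word_eq => k ku.
  have ck : (c + k < K)%N by lia.
  by have := zy (Ordinal ck); rewrite ffunE /= PoszD.
rewrite inE; apply/asboolP; exists (fun j => y (j + - (i * K)%N%:Z)).
  exact: shift_closed.
apply/ffunP => j; apply/ffunP => l; rewrite !ffunE; have lK := ltn_ord l.
case: eqP => [->|/eqP ji]; first by rewrite !ffunE; congr y; lia.
rewrite !ffunE yx; first by congr x; lia.
have [ij|ij] : (i.+1 <= j \/ j.+1 <= i)%N.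
- by move: ji; rewrite -val_eqE /=; lia.
- have : (i.+1 * K <= j * K)%N by rewrite leq_mul2r ij orbT.
  by rewrite mulSn; lia.
- have : (j.+1 * K <= i * K)%N by rewrite leq_mul2r ij orbT.
  by rewrite mulSn; lia.
Qed.

Hypothesis wandering : forall p (z : X), (0 < p)%N ->
  word (val_point z) 0 (size u) = u ->
  word (val_point (iter p phi z)) 0 (size u) <> u.

(* By wandering each site sees [u] at most once along an orbit, so over [N]
   time steps some image of [y] sees [u] in few blocks. *)
Let orbit_poor K N q (y : X) : (0 < N)%N -> exists j : 'I_N,
  (#|[pred i | good (blocks K (N * q) (val_point (iter j phi y)) i)]| <= q * K.+1)%N.
Proof.
move=> N0; apply: contrapT => nex.
pose M := (N * q)%N.
(* The offset [c = K] is included because [c + size u <= K] allows it when [u] is empty. *)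
pose occ (j : 'I_N) (i : 'I_M) (c : 'I_K.+1) : bool :=
  word (val_point (iter j phi y)) (i * K + c)%N%:Z (size u) == u.
have occ1 i c : (\sum_(j < N) occ j i c <= 1)%N.
  rewrite -big_mkcond /= sum1_card; apply/card_le1_eqP => j j'.
  wlog jj' : j j' / (j <= j')%N => [wl|].
    by have [|/ltnW] := leqP j j'; [exact: wl | move=> h a b; apply/esym/wl].
  rewrite !unfold_in => /eqP uj /eqP uj'; apply/val_inj/eqP => /=.
  move: jj'; rewrite leq_eqVlt eq_sym => /orP[//|lt_jj'].
  pose z := iter (i * K + c) shift_point (iter j phi y).
  have zu : word (val_point z) 0 (size u) = u.
    by rewrite -{2}uj; apply/word_eq => k _; rewrite val_iter_shift; congr (val_point _ _); lia.
  have := @wandering (j' - j)%N z; rewrite subn_gt0 => /(_ lt_jj' zu); case.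
  rewrite /z iter_ca_shift -iterD subnK; last exact: ltnW.
  by rewrite -{2}uj'; apply/word_eq => k _; rewrite val_iter_shift; congr (val_point _ _); lia.
have le_occ (j : 'I_N) : (#|[pred i | good (blocks K M (val_point (iter j phi y)) i)]| <=
    \sum_(i < M) \sum_(c < K.+1) occ j i c)%N.
  rewrite -sum1_card big_mkcond; apply: leq_sum => i _; rewrite inE.
  case: ifP => // /good_blocks[c cK cu].
  have cK' : (c < K.+1)%N by lia.
  by rewrite (bigD1 (Ordinal cK')) //= /occ cu eqxx.
(* Double counting of occurrences of [u]: too many at every time, at most one for each offset in a
   block. This is absurd since [M = N * q]. *)
have : (N * (q * K.+1).+1 <= M * K.+1)%N.
  apply: (@leq_trans (\sum_(j < N) \sum_(i < M) \sum_(c < K.+1) occ j i c)%N).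
    rewrite -[X in (X * _)%N]card_ord -sum_nat_const; apply: leq_sum => j _.
    apply: leq_trans (le_occ j); rewrite ltnNge; apply/negP => h.
    by apply: nex; exists j.
  rewrite exchange_big /= -[X in (X * _)%N]card_ord -sum_nat_const; apply: leq_sum => i _.
  rewrite exchange_big /= -[X in (_ <= X)%N]card_ord -sum1_card; apply: leq_sum => c _.
  exact: occ1.
by rewrite /M mulnS -mulnA; lia.
Qed.

(* A point is determined on a long interval by the time at which its orbit is
   poor, the poor blocks seen then, and the two margins of width [r']. *)
Let admissible_bound K N : (0 < N)%N -> exists C : nat, forall q,
  (#|admissible K (N * q)| <= C * #|[set w in admissible K (N * q) |
      (#|[pred i | good (w i)]| <= q * K.+1)%N]%SET|)%N.
Proof.
move=> N0.
have /choice[r rP] := iter_ca_radius phi.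
pose r' := \max_(j < N.+1) r j.
pose E := {ffun 'I_r' -> A}.
exists #|{: 'I_N * E * E}| => q.
set W := admissible K (N * q); set P := finset _.
pose T := (N * q * K)%N.
pose left (z : X) : E := [ffun i : 'I_r' => val_point z (- i.+1%:Z)].
pose right (z : X) : E := [ffun i : 'I_r' => val_point z (T + i)%N%:Z].
(* For [y] with [phi^N y] carrying [v], record a poor time [j] of its orbit and the point [phi^j y],
   which reaches [v] after [N - j] more steps. *)
have /choice[jz jzP] : forall v, exists jz : 'I_N * X, v \in W ->
    blocks K (N * q) (val_point jz.2) \in P /\
    blocks K (N * q) (val_point (iter (N - jz.1) phi jz.2)) = v.
  move=> v; have [vW|nvW] := pselect (v \in W); last first.
    by exists (Ordinal N0, base_point X).
  have /asboolP[x Xx <-] : `[< exists2 x, subshift_set X x & blocks K (N * q) x = v >].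
    by move: vW; rewrite inE.
  have onto n (p : X) : exists p', iter n phi p' = p.
    elim: n p => [|n IH] p; first by exists p.
    have [p1 p1p] := IH p.
    have [p2 _ p2p] : range phi p1 by rewrite surj_phi.
    by exists p2; rewrite iterSr p2p.
  have [y yx] := onto N (exist _ x (mem_set Xx)).
  have [j jpoor] := orbit_poor K q y N0.
  exists (j, iter j phi y) => _ /=; split; last first.
    by rewrite -iterD subnK ?yx// ltnW.
  rewrite inE jpoor andbT inE; apply/asboolP.
  by exists (val_point (iter j phi y)) => //; exact: set_valP.
pose code v := ((jz v).1, left (jz v).2, right (jz v).2,
  blocks K (N * q) (val_point (jz v).2)).
have code_inj : {in W &, injective code}.
  move=> v v' vW v'W [ej el er eb].
  have [_ <-] := jzP v vW; have [_ <-] := jzP v' v'W; rewrite -ej.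
  move: (jz v).1 (jz v).2 (jz v').2 el er eb => j z z' el er eb.
  apply: eq_blocks => k kT; apply: rP => l lr.
  have rr' : (r (N - j) <= r')%N.
    have jN : (N - j < N.+1)%N by lia.
    exact: (@leq_bigmax _ (fun i : 'I_N.+1 => r i) (Ordinal jN)).
  have : `|(k%:Z + l) - k%:Z| <= r (N - j)%N by lia.
  move: (k%:Z + l) => m mr.
  have [l0|l0] := ltP m 0.
    have lr' : (`|m|%N.-1 < r')%N by lia.
    move/ffunP: el => /(_ (Ordinal lr')); rewrite !ffunE /=.
    by have -> : - (`|m|%N.-1.+1)%:Z = m by lia.
  have [lT|lT] := ltnP `|m|%N T.
    by have := blocks_eq eb lT; have -> : `|m|%N%:Z = m by lia.
  have lr' : (`|m|%N - T < r')%N by lia.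
  move/ffunP: er => /(_ (Ordinal lr')); rewrite !ffunE /=.
  by have -> : (T + (`|m|%N - T))%N%:Z = m by lia.
rewrite -(card_in_imset code_inj) -cardsT -cardsX; apply/subset_leq_card/fintype.subsetP.
by move=> _ /imsetP[v vW ->]; rewrite inE /= inE; have [] := jzP v vW.
Qed.

(** On [N * C] blocks the poor words have at most [C * K.+1] good blocks, so their share is at most
    [(2^(K+1) (1-d)^N)^C], which is at most [2^-C]. But all admissible words number at most [C]
    times the poor ones, which gives [2^C <= C]. *)
Lemma wandering_absurd : False.
Proof.
have [K KP] := admissible_update.
pose B := {ffun 'I_K -> A}.
have [x Xx _] := uX.
have B0 : (0 < #|{: B}|)%N.
  by apply/card_gt0P; exists [ffun c : 'I_K => x (c : nat)%:Z].
pose d : rat := (2 * #|{: B}|%:R)^-1.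
have d0 : 0 < d by rewrite invr_gt0 mulr_gt0// ltr0n.
have d1 : d <= 1 by rewrite invf_le1 ?invr_gt0 -?natrM ?ler1n ?ltr0n muln_gt0.
have bernoulli n : (1 - d) ^+ n * (1 + n%:R * d) <= 1.
  elim: n => [|n IH]; first by rewrite expr0 mul0r addr0 mul1r.
  apply: le_trans IH; rewrite exprSr -mulrA ler_wpM2l ?exprn_ge0 ?subr_ge0//.
  have : 0 <= n.+1%:R * d * d by rewrite !mulr_ge0 ?ler0n// ltW.
  by rewrite -natr1; lra.
have [N N0 tN] : exists2 N, (0 < N)%N & 2 ^+ K.+1 * (1 - d) ^+ N <= 2^-1.
  (* This makes [N d] equal to [2^(K+2)], twice the factor to be beaten in Bernoulli's
     inequality. *)
  pose N := (2 ^ K.+2 * (2 * #|{: B}|))%N.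
  exists N; first by rewrite muln_gt0 expn_gt0 muln_gt0 B0.
  have Nd : N%:R * d = 2 ^+ K.+2.
    by rewrite natrM natrX natrM /d -mulrA divff ?mulr1// mulf_neq0// pnatr_eq0 -lt0n.
  have e0 : 0 <= (1 - d) ^+ N by rewrite exprn_ge0 ?subr_ge0.
  have := bernoulli N; rewrite Nd (exprS _ K.+1).
  by move: ((1 - d) ^+ N) (2 ^+ K.+1 : rat) e0 => b t b0; nra.
have [C CP] := admissible_bound K N0.
pose W := admissible K (N * C).
have W0 : 0 < #|W|%:R :> rat.
  rewrite ltr0n; apply/card_gt0P; exists (blocks K (N * C) x).
  by rewrite inE; apply/asboolP; exists x.
have := CP C; rewrite -/W -(ler_nat rat) natrM.
have := @few_good_blocks _ (@good K) (N * C) rat W (C * K.+1) (KP _).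
rewrite -/B -/d (mulnC C) 2!exprM -exprMn.
set P := #|_|; move=> hP hW.
have : #|W|%:R <= C%:R * (2^-1 ^+ C * #|W|%:R) :> rat.
  apply: (le_trans hW); apply: ler_wpM2l => //; apply: (le_trans hP).
  apply: ler_wpM2r => //; apply: lerXn2r tN; rewrite nnegrE ?invr_ge0//.
  by rewrite mulr_ge0 ?exprn_ge0// subr_ge0.
rewrite mulrA -[leLHS]mul1r ler_pM2r// exprVn ler_pdivlMr ?exprn_gt0// mul1r.
by rewrite -natrX ler_nat leqNgt ltn_expl.
Qed.

End nonwandering.

(** The window of [x] spells a word of length [2n + 1]; a shift by [n] moves it to the origin, where
    [wandering_absurd] applies. *)
Lemma nonwandering (A : finType) (X : subshift A)
    (phi : cellular_automaton X) (s : nat) (x : X) (n : nat) :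
  glues X s -> irreducible X -> range phi = [set: X] -> (s <= n)%N ->
  exists2 p, (0 < p)%N & exists2 y, Bset n x y & Bset n x (iter p phi y).
Proof.
move=> gs irrX surj sn; apply: contrapT => nex.
pose u := word (val_point x) (- n%:Z) (n + n).+1.
have uE : size u = (n + n).+1 by rewrite size_mkseq.
have Bset_word y : word (val_point y) 0 (size u) = u -> Bset n x (iter n shift_point y).
  rewrite uE => /word_eq yu j jn; rewrite val_iter_shift.
  have := yu `|(j + n%:Z)%R|%N; rewrite add0r.
  have -> : `|(j + n%:Z)%R|%N%:Z = j + n%:Z by lia.
  by move=> ->; [congr (val_point x); lia|lia].
apply: (@wandering_absurd A X phi s u gs irrX _ _ surj _).
- by rewrite uE; lia.
- exists (fun j => val_point x (j + - n%:Z)); first exact/shift_closed/set_valP.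
  by rewrite uE; apply/word_eq => i _; congr (val_point x); lia.
- move=> p z p0 zu pzu; apply: nex; exists p => //.
  exists (iter n shift_point z); first exact: Bset_word.
  by rewrite iter_ca_shift; exact: Bset_word.
Qed.

(* A return to the window of an equicontinuity point repeats the whole window
   orbit, which is therefore purely periodic. *)
Lemma equicontinuity_periodic (A : finType) (X : subshift A)
    (phi : cellular_automaton X) (x : X) (m : nat) :
  is_sft X -> irreducible X -> range phi = [set: X] ->
  equicontinuity_points phi x ->
  exists2 p, (0 < p)%N & forall i, agree_on_window m x (iter (p * i) phi x).
Proof.
move=> /sft_glues[s gs] irrX surj /(_ m)[n xn].
have xn' : Bset (maxn n s) x `<=` Oset phi m x.
  by move=> y /(agree_le (leq_maxl _ _))/xn.
have [p p0 [y /xn' xy /xn' xpy]] := nonwandering x gs irrX surj (leq_maxr n s).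
exists p => // i; elim: i => [|i IH]; first by rewrite muln0.
(* Both [y] and [phi^p y] share the window orbit of [x]: compare [phi^p y] at time [p i], then [y]
   at time [p (i + 1)]. *)
apply: agree_trans IH (agree_trans (xpy (p * i)%N) _).
by rewrite -iterD mulnSr; exact/agree_sym/xy.
Qed.

(** * Shift averages for an ergodic measure *)

Section bounded_functions.
Context d (T : measurableType d) (R : realType) (P : probability T R).
Implicit Types f g : T -> R.

Definition bounded_measurable f :=
  measurable_fun setT f /\ exists C, forall x, `|f x| <= C.

Lemma bounded_measurable_integrable f :
  bounded_measurable f -> P.-integrable setT (EFin \o f).
Proof.
move=> [mf [C fC]]; apply: measurable_bounded_integrable => //.
  by rewrite (le_lt_trans (probability_le1 P measurableT))// ltry.
by exists C; split => [|y Cy x _]; rewrite ?num_real//; exact/(le_trans (fC x))/ltW.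
Qed.

Lemma bounded_measurable_comp f (h : T -> T) : measurable_fun setT h ->
  bounded_measurable f -> bounded_measurable (f \o h).
Proof.
move=> mh [mf [C fC]]; split; first exact: measurableT_comp.
by exists C => x; exact: fC.
Qed.

Lemma bounded_measurable_cst (c : R) : bounded_measurable (fun=> c).
Proof. by split; [exact: measurable_cst | exists `|c|]. Qed.

Lemma bounded_measurableD f g : bounded_measurable f -> bounded_measurable g ->
  bounded_measurable (fun x => f x + g x).
Proof.
move=> [mf [C fC]] [mg [D gD]]; split; first exact: measurable_funD.
by exists (C + D) => x; exact: le_trans (ler_normD _ _) (lerD (fC x) (gD x)).
Qed.

Lemma bounded_measurableZ (c : R) f : bounded_measurable f ->
  bounded_measurable (fun x => c * f x).
Proof.
move=> [mf [C fC]]; split; first by apply: measurable_funM => //; exact: measurable_cst.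
by exists (`|c| * C) => x; rewrite normrM ler_wpM2l.
Qed.

Lemma bounded_measurableN f : bounded_measurable f ->
  bounded_measurable (fun x => - f x).
Proof.
move=> /(bounded_measurableZ (-1)); rewrite (_ : (fun x => -1 * f x) = fun x => - f x)//.
by apply/funext => x; rewrite mulN1r.
Qed.

Lemma bounded_measurable_max f g : bounded_measurable f -> bounded_measurable g ->
  bounded_measurable (fun x => Num.max (f x) (g x)).
Proof.
move=> [mf [C fC]] [mg [D gD]]; split; first exact: measurable_maxr.
exists (Num.max C D) => x; rewrite le_max.
by case: (leP (f x) (g x)) => _; rewrite ?fC ?gD ?orbT.
Qed.

Lemma RintegralB_cst f c : bounded_measurable f ->
  \int[P]_x (f x - c) = \int[P]_x f x - c.
Proof.
move=> bf; rewrite RintegralB//; try exact: bounded_measurable_integrable.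
  rewrite Rintegral_cst// -[in RHS](mulr1 c); congr (_ - _ * _).
  exact: (congr1 fine (probability_setT P)).
exact/bounded_measurable_integrable/bounded_measurable_cst.
Qed.

Lemma ae_of_measure1 (B : set T) : measurable B -> P B = 1%E ->
  {ae P, forall x, B x}.
Proof.
move=> mB PB; exists (~` B); split => //; first exact: measurableC.
by rewrite probability_setC// PB subee.
Qed.

Lemma bounded_convergence (f_ : nat -> T -> R) f C :
  (forall n, measurable_fun setT (f_ n)) -> measurable_fun setT f ->
  (forall n x, `|f_ n x| <= C) ->
  {ae P, forall x, f_ n x @[n --> \oo] --> f x} ->
  \int[P]_x f_ n x @[n --> \oo] --> \int[P]_x f x.
Proof.
move=> mf_ mf fC cf.
have [] := @dominated_convergence _ _ _ P setT measurableT (fun n => EFin \o f_ n)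
  (EFin \o f) (cst C%:E).
- by move=> n; exact/measurable_EFinP.
- exact/measurable_EFinP.
- by apply: filterS cf => x fx _; apply: cvg_EFin => //; exact: nearW.
- by apply: (@bounded_measurable_integrable (fun=> C)); exact: bounded_measurable_cst.
- by apply: aeW => x n _; rewrite lee_fin.
move=> intf _ cvg; apply: fine_cvg => /=.
by rewrite fineK//; exact: integrable_fin_num intf.
Qed.

End bounded_functions.

(** * Maximal sums along orbits *)

Section invariant_measure.
Context d (T : measurableType d) (R : realType) (P : probability T R).
Variable theta : T -> T.
Hypotheses (mtheta : measurable_fun setT theta)
  (invP : forall B, measurable B -> P (theta @^-1` B) = P B).

Lemma Rintegral_invariant (f : T -> R) : bounded_measurable f ->
  \int[P]_x f (theta x) = \int[P]_x f x.
Proof.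
move=> bf; rewrite /Rintegral; congr fine.
have := @integral_pushforward _ _ _ _ _ theta mtheta P setT (EFin \o f) _ _ measurableT.
rewrite preimage_setT => <- //; last 2 first.
- exact/measurable_EFinP/(proj1 bf).
- by apply: (@bounded_measurable_integrable _ _ _ P (f \o theta)); exact: bounded_measurable_comp.
apply: eq_measure_integral => B mB _; exact: invP.
Qed.

Variable g : T -> R.
Hypothesis bg : bounded_measurable g.

(* [maxsum n x] is the largest of the sums of [g] along the first [k] points of
   the orbit of [x], for [0 <= k <= n]. *)
Fixpoint maxsum (n : nat) (x : T) : R :=
  if n is m.+1 then Num.max 0 (g x + maxsum m (theta x)) else 0.

Lemma maxsum_bounded_measurable n : bounded_measurable (maxsum n).
Proof.
elim: n => [|n IH] /=; first exact: bounded_measurable_cst.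
apply: bounded_measurable_max; first exact: bounded_measurable_cst.
by apply: bounded_measurableD => //; exact: (bounded_measurable_comp mtheta IH).
Qed.

Lemma maxsum_ge0 n x : 0 <= maxsum n x.
Proof. by case: n => [|n] //=; rewrite le_max lexx. Qed.

Lemma maxsum_leS n x : maxsum n x <= maxsum n.+1 x.
Proof.
elim: n x => [|n IH] x; first exact: maxsum_ge0.
by rewrite /= ge_max !le_max lexx /= lerD2l IH orbT.
Qed.

Lemma maxsum_le m n x : (m <= n)%N -> maxsum m x <= maxsum n x.
Proof. by move=> mn; apply: (homo_leq le_refl le_trans (fun n => maxsum_leS n x)). Qed.

Lemma maxsum_le_mul C n x : (forall y, `|g y| <= C) -> maxsum n x <= n%:R * C.
Proof.
move=> gC; have C0 : 0 <= C by exact: le_trans (gC x).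
elim: n x => [|n IH] x /=; first by rewrite mul0r.
rewrite ge_max mulr_ge0//= -natr1 mulrDl mul1r addrC lerD//.
exact: le_trans (ler_norm _) (gC x).
Qed.

(** [maxsum n] dominates the sum of [g] over the first [n] orbit points, whose integral is [n] times
    that of [g] by invariance. *)
Lemma Rintegral_le_maxsum n :
  n%:R * \int[P]_x g x <= \int[P]_x maxsum n x.
Proof.
elim: n => [|n IH]; first by rewrite mul0r Rintegral_ge0.
have bn := maxsum_bounded_measurable n.
have bn' := bounded_measurable_comp mtheta bn.
rewrite -natr1 mulrDl mul1r; apply: (le_trans (lerD IH (lexx _))).
rewrite -(Rintegral_invariant bn) addrC -RintegralD//; try exact: bounded_measurable_integrable.
apply: le_Rintegral => //; [|exact/bounded_measurable_integrable/(maxsum_bounded_measurable n.+1)|].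
  by apply: bounded_measurable_integrable; exact: bounded_measurableD.
by move=> x _; rewrite /= le_max lexx orbT.
Qed.

Let unbounded := [set x | forall k : nat, exists n, k%:R < maxsum n x].

Let unbounded_measurable : measurable unbounded.
Proof.
have -> : unbounded = \bigcap_k \bigcup_n [set x | k%:R < maxsum n x].
  apply/seteqP; split=> x /= h k; first by move=> _; have [n kn] := h k; exists n.
  by have [n _ kn] := h k I; exists n.
apply: bigcapT_measurable => k; apply: bigcupT_measurable => n.
have := proj1 (maxsum_bounded_measurable n) measurableT _ (measurable_itv `]k%:R, +oo[).
rewrite setTI; congr measurable; apply/seteqP; split=> x /=.
  by rewrite in_itv /= andbT.
by rewrite in_itv /= andbT.
Qed.

(** One step along the orbit shifts the maximal sums by at most a bound of [g], which cannot affect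
    whether they are bounded. *)
Let unbounded_invariant : theta @^-1` unbounded = unbounded.
Proof.
have [_ [C gC]] := bg.
have CN : C <= (Num.truncn C).+1%:R by exact/ltW/truncnS_gt.
set N := (Num.truncn C).+1 in CN.
have gN x : `|g x| <= N%:R by exact: le_trans (gC x) CN.
apply/seteqP; split=> x /= h k.
  have [n nk] := h (k + N)%N; exists n.+1; rewrite /= lt_max; apply/orP; right.
  by move: nk (gN x); rewrite natrD ler_norml; lra.
have [[|n] nk] := h (k + N)%N; first by move: nk; rewrite /= ltNge ler0n.
exists n; move: nk (gN x); rewrite /= lt_max natrD ler_norml.
have : 0 <= k%:R + N%:R :> R by rewrite -natrD ler0n.
by move=> h0 /orP[|]; [lra|lra].
Qed.

Let unbounded_mean_ge0 : P unbounded = 1%E -> 0 <= \int[P]_x g x.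
Proof.
move=> PB; have [mg [C gC]] := bg.
(* By [fE] and invariance the integral of [f n] is that of [maxsum n.+1 - maxsum n], hence
   nonnegative. Where the maximal sums outgrow the bound of [g], [f n] equals [g] from some [n]
   on. *)
pose f n x := Num.max (- maxsum n (theta x)) (g x).
have bf n : bounded_measurable (f n).
  apply: bounded_measurable_max => //; apply: bounded_measurableN.
  exact: (bounded_measurable_comp mtheta (maxsum_bounded_measurable n)).
have fE n x : f n x = maxsum n.+1 x - maxsum n (theta x).
  by rewrite /f /= addr_maxl sub0r addrK.
have f0 n : 0 <= \int[P]_x f n x.
  under eq_Rintegral do rewrite fE.
  rewrite RintegralB//; try exact/bounded_measurable_integrable.
  - by rewrite (Rintegral_invariant (maxsum_bounded_measurable n)) subr_ge0 le_Rintegral//;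
      [| |move=> x _; exact: maxsum_leS];
      exact/bounded_measurable_integrable/maxsum_bounded_measurable.
  - exact/bounded_measurable_integrable/(maxsum_bounded_measurable n.+1).
  - exact/bounded_measurable_integrable/(bounded_measurable_comp mtheta)/maxsum_bounded_measurable.
have : \int[P]_x f n x @[n --> \oo] --> \int[P]_x g x.
  apply: (@bounded_convergence _ _ _ _ _ _ C) => //.
  - by move=> n; case: (bf n).
  - move=> n x; rewrite /f; have := gC x; have := maxsum_ge0 n (theta x).
    by rewrite !ler_norml; case: (leP (- maxsum n (theta x)) (g x)) => //; lra.
  - apply: filterS (ae_of_measure1 unbounded_measurable PB) => x.
    rewrite -unbounded_invariant => /(_ (Num.truncn C).+1)[m mC].
    apply: cvg_near_cst; exists m => // n /= mn.
    apply/max_idPr; have := maxsum_le (theta x) mn; have := gC x; have := truncnS_gt C.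
    by rewrite ler_norml; lra.
by move=> cf; rewrite -(cvg_lim _ cf)//; apply: limr_ge (cvgP _ cf) (nearW _ f0).
Qed.

Hypothesis ergP : forall B, measurable B -> theta @^-1` B = B ->
  P B = 0%E \/ P B = 1%E.

(* The points with unbounded maximal sums form an invariant set. It cannot have
   measure 1, since the increments of [maxsum] have nonnegative integral and
   would converge to [g]; so it is null. *)
Lemma maxsum_mean_cvg0 : \int[P]_x g x < 0 ->
  n%:R^-1 * (\int[P]_x maxsum n x) @[n --> \oo] --> (0 : R).
Proof.
move=> g0; have [mg [C gC]] := bg.
have PB : P (~` unbounded) = 1%E.
  rewrite probability_setC//.
  have [->|/unbounded_mean_ge0] := ergP unbounded_measurable unbounded_invariant.
    by rewrite sube0.
  by rewrite leNgt g0.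
have -> : (fun n => n%:R^-1 * (\int[P]_x maxsum n x)) =
    (fun n => \int[P]_x (n%:R^-1 * maxsum n x)).
  apply/funext => n; rewrite RintegralZl//.
  exact/bounded_measurable_integrable/maxsum_bounded_measurable.
have <- : \int[P]_x (0 : R) = 0 by rewrite Rintegral_cst// mul0r.
apply: (@bounded_convergence _ _ _ _ _ _ C) => //.
- by move=> n; apply: (proj1 (bounded_measurableZ _ _)); exact: maxsum_bounded_measurable.
- move=> [|n] x; first by rewrite invr0 mul0r normr0 (le_trans _ (gC x)).
  rewrite ger0_norm ?mulr_ge0 ?invr_ge0 ?maxsum_ge0//.
  by rewrite ler_pdivrMl ?ltr0n// maxsum_le_mul.
- apply: filterS (ae_of_measure1 (measurableC unbounded_measurable) PB) => x /=.
  move=> /existsNP[k /forallNP kn].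
  have kn' n : maxsum n x <= k%:R by rewrite leNgt; apply/negP.
  apply: (@squeeze_cvgr _ _ _ _ (cst 0) (fun n => n%:R^-1 * k%:R)).
  + by apply: nearW => n; rewrite mulr_ge0 ?maxsum_ge0 ?invr_ge0//= ler_wpM2l ?invr_ge0.
  + exact: cvg_cst.
  + rewrite -cvg_shiftS /=.
    by have := cvgM (@cvg_harmonic R) (cvg_cst (k%:R : R)); rewrite mul0r; apply.
Qed.

End invariant_measure.

(** * Window sets *)

Section window_sets.
Context (A : finType) (X : subshift A).
Implicit Types (G : set X) (x y : X).

(** These are the finite unions of cylinders over the window; being clopen, they have continuous
    indicators, to which weak limits apply. *)
Definition window_set n G := forall x y, agree_on_window n x y -> G x -> G y.

Lemma window_setC n G : window_set n G -> window_set n (~` G).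
Proof. by move=> wG x y /agree_sym xy; apply: contra_not; exact: wG. Qed.

Lemma open_of_agree G : (forall x, G x -> exists n, Bset n x `<=` G) -> open G.
Proof.
move=> oG; rewrite openE => x /oG[n nG].
exact: filterS nG (Bset_nbhs x n).
Qed.

Lemma open_measurable_points G : open G -> measurable G.
Proof. exact: sub_sigma_algebra. Qed.

Lemma window_set_open n G : window_set n G -> open G.
Proof. by move=> wG; apply: open_of_agree => x Gx; exists n => y xy; exact: wG xy Gx. Qed.

Lemma measurable_continuous (R : realType) (f : X -> R) :
  continuous f -> measurable_fun setT f.
Proof.
move=> /continuousP cf; apply: (measurability _ (RGenOpens.measurableE R)).
move=> _ [_ [a [b ->] <-]]; rewrite setTI; apply: open_measurable_points.
by apply: cf; exact: interval_open.
Qed.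

Lemma window_indic_continuous (R : realType) n G : window_set n G ->
  continuous (\1_G : X -> R).
Proof.
move=> wG x U xU; apply: filterS (Bset_nbhs x n) => y xy /=.
suff -> : \1_G y = \1_G x :> R by exact: nbhs_singleton.
rewrite !indicE; congr (nat_of_bool _)%:R.
by apply/idP/idP => /set_mem h; apply/mem_set; [exact: wG (agree_sym xy) h|exact: wG xy h].
Qed.

Lemma window_indic_bounded (R : realType) n G : window_set n G ->
  bounded_measurable (\1_G : X -> R).
Proof.
move=> wG; split; first exact: measurable_continuous (window_indic_continuous wG).
by exists 1 => x; rewrite indicE; case: (x \in G); rewrite ?normr1 ?normr0.
Qed.

(** Window sets are stable under intersection, and each open set is a countable union of them, so
    measures are determined by their values there. *)
Lemma eq_measure_window (R : realType) (m1 m2 : probability X R) :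
  (forall n G, window_set n G -> m1 G = m2 G) ->
  forall B : set X, measurable B -> m1 B = m2 B.
Proof.
move=> m12; apply: (measure_unique [set G | exists n, window_set n G] (fun=> setT)).
- apply/seteqP; split=> B; last first.
    apply: smallest_sub; first exact: sigma_algebra_measurable.
    by move=> G [n /window_set_open]; exact: open_measurable_points.
  apply: smallest_sub; first exact: smallest_sigma_algebra.
  move=> O oO; have -> : O = \bigcup_n [set x | Bset n x `<=` O].
    apply/seteqP; split=> x; last by case=> n _; apply; exact: agree_refl.
    move=> Ox; have [n nO] := nbhs_Bset (open_nbhs_nbhs (conj oO Ox)).
    by exists n.
  apply: (@bigcupT_measurable _ (g_sigma_algebraType _)) => n.
  apply: sub_sigma_algebra; exists n => x y xy xO z yz; apply: xO.
  exact: agree_trans xy yz.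
- move=> G H [n nG] [m mH]; exists (maxn n m) => x y xy [Gx Hx]; split.
    exact: nG (agree_le (leq_maxl _ _) xy) Gx.
  exact: mH (agree_le (leq_maxr _ _) xy) Hx.
- by move=> _; exists 0%N.
- by rewrite bigcup_const//; exists 0%N.
- by move=> G [n /m12].
- by move=> _; rewrite (le_lt_trans (probability_le1 m1 measurableT))// ltry.
Qed.

Lemma shift_point_continuous : continuous (@shift_point A X).
Proof.
move=> x U /nbhs_Bset[n nU]; apply: (filterS _ (Bset_nbhs x n.+1)) => y xy.
by apply: nU => j jn; apply: (xy (j + 1)); lia.
Qed.

Lemma shift_point_measurable : measurable_fun setT (@shift_point A X).
Proof.
apply: (@measurability _ _ X X _ _ (@open X)) => // _ [B oB <-].
rewrite setTI; apply: open_measurable_points.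
by move/continuousP: shift_point_continuous; apply.
Qed.

(** Makes the maximal sums test functions for the weak limit. *)
Lemma maxsum_continuous (R : realType) (g : X -> R) n : continuous g ->
  continuous (maxsum shift_point g n).
Proof.
have max0D (T : topologicalType) (f h : T -> R) : continuous f -> continuous h ->
    continuous (fun t => Num.max 0 (f t + h t)).
  move=> cf ch t; apply: (@continuous_max _ _ (fun=> 0) (fun t => f t + h t)).
    exact: cvg_cst.
  by apply: cvgD; [exact: cf|exact: ch].
move=> cg; elim: n => [|n IH]; first exact: (@cst_continuous X R 0).
apply: max0D cg _ => x.
apply: (@continuous_comp _ _ _ (@shift_point A X) (maxsum shift_point g n)); last exact: IH.
exact: shift_point_continuous.
Qed.

End window_sets.

(** * Measurability of equicontinuity and of window periodicity *)

Section equicontinuity_measurable.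
Context (A : finType) (X : subshift A) (phi : cellular_automaton X).

(** The inclusion of [Bset n x] in [Oset m x] passes to all points of [Bset n x], so this is a
    countable intersection of open sets. *)
Lemma equicontinuity_points_measurable : measurable (equicontinuity_points phi).
Proof.
have -> : equicontinuity_points phi =
    \bigcap_m \bigcup_n [set x | Bset n x `<=` Oset phi m x].
  apply/seteqP; split=> x h m.
    by move=> _; have [n nm] := h m; exists n.
  by have [n _ nm] := h m I; exists n.
apply: bigcapT_measurable => m; apply: bigcupT_measurable => n.
apply: open_measurable_points; apply: open_of_agree => x xO; exists n => y xy z yz i.
apply: agree_trans (agree_sym (xO _ xy i)) _; apply: xO.
exact: agree_trans xy yz.
Qed.

Lemma window_periodic_measurable m p :
  measurable [set x | forall i, agree_on_window m x (iter (p * i) phi x)].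
Proof.
have -> : [set x | forall i, agree_on_window m x (iter (p * i) phi x)] =
    \bigcap_i [set x | agree_on_window m x (iter (p * i) phi x)].
  by apply/seteqP; split=> x h i; [move=> _; exact: h | exact: h].
apply: bigcapT_measurable => i; apply: open_measurable_points.
apply: open_of_agree => x xp.
have [n nP] := nbhs_Bset (@iter_ca_continuous _ _ phi (p * i) x _ (Bset_nbhs _ m)).
exists (maxn n m) => y xy.
apply: agree_trans (agree_sym (agree_le (leq_maxr n m) xy)) _.
exact: agree_trans xp (nP _ (agree_le (leq_maxl n m) xy)).
Qed.

End equicontinuity_measurable.

(** * Cesaro limits *)

Section cesaro.
Context (R : realType) (A : finType) (X : subshift A).
Context (phi : cellular_automaton X) (mu : probability X R).

Lemma iter_ca_bounded_measurable i (f : X -> R) :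
  bounded_measurable f -> bounded_measurable (fun x => f (iter i phi x)).
Proof. exact: (@bounded_measurable_comp _ _ _ f _ (@iter_ca_measurable _ _ phi i)). Qed.

Lemma Rintegral_distribution_ca i (f : X -> R) : bounded_measurable f ->
  \int[distribution mu (ca_iter phi i)]_x f x = \int[mu]_x f (iter i phi x).
Proof.
move=> bf; rewrite /Rintegral; congr fine.
rewrite [LHS](@integral_pushforward _ _ _ _ _ (iter i phi) _ mu setT (EFin \o f))//.
- exact: iter_ca_measurable.
- by apply/measurable_EFinP; case: bf.
- exact: (bounded_measurable_integrable mu (iter_ca_bounded_measurable i bf)).
Qed.

Lemma integral_cesaro n (f : X -> R) : bounded_measurable f -> (forall x, 0 <= f x) ->
  (\int[cesaro_mean phi mu n]_x (f x)%:E)%E =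
  (n%:R^-1 * \sum_(i < n) \int[mu]_x f (iter i.+1 phi x))%:E.
Proof.
move=> bf f0; have mf : measurable_fun setT (EFin \o f) by apply/measurable_EFinP; case: bf.
have f0' x : setT x -> (0 <= (f x)%:E)%E by rewrite lee_fin.
rewrite [LHS]ge0_integral_mscale// ge0_integral_measure_sum//= EFinM; congr (_ * _)%E.
rewrite -sumEFin; apply: eq_bigr => i _.
rewrite -(Rintegral_distribution_ca i.+1 bf) /Rintegral fineK//.
by apply: integrable_fin_num => //; exact: bounded_measurable_integrable.
Qed.

Lemma weak_limit_Rintegral (nu : probability X R) (f : X -> R) :
  weak_limit (cesaro_mean phi mu) nu -> continuous f -> bounded_measurable f ->
  (forall x, 0 <= f x) ->
  n%:R^-1 * (\sum_(i < n) \int[mu]_x f (iter i.+1 phi x)) @[n --> \oo] --> \int[nu]_x f x.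
Proof.
move=> lim cf bf f0; have := lim f cf.
under eq_cvg do rewrite integral_cesaro//.
have fin : (\int[nu]_x (f x)%:E)%E \is a fin_num.
  by apply: integrable_fin_num => //; exact: bounded_measurable_integrable.
by rewrite -(fineK fin) => /fine_cvg.
Qed.

Lemma le_cvg_multiples (u : nat -> R) (a b l : R) p : (0 < p)%N ->
  u n @[n --> \oo] --> l -> (forall k, (0 < k)%N -> a <= b * u (p * k)%N) ->
  a <= b * l.
Proof.
move=> p0 ul au; have bl : b * u (p * k)%N @[k --> \oo] --> b * l.
  by apply: cvgM; [exact: cvg_cst|exact: (cvg_comp _ _ (cvg_mulnl p p0) ul)].
rewrite -(cvg_lim _ bl)//; apply: limr_ge (cvgP _ bl) _.
by exists 1%N => // k; exact: au.
Qed.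

(** Source of the factor [p]: a mean over [n] multiples of [p] is at most [p] times the mean over
    all times up to [p n]. *)
Lemma sum_multiples_le (F : nat -> R) p n : (0 < p)%N -> (forall k, 0 <= F k) ->
  \sum_(i < n) F (p * i.+1)%N <= \sum_(k < p * n) F k.+1.
Proof.
case: p => // p _ F0; elim: n => [|n IH]; first by rewrite muln0 !big_ord0.
rewrite big_ord_recr /= (mulnSr p.+1 n) addnS big_ord_recr /= lerD//.
  by rewrite big_split_ord /= -[leLHS]addr0 lerD// sumr_ge0.
Qed.

End cesaro.

(** * Invariance of the limit under the automaton *)

Section limit_measure.
Context (R : realType) (A : finType) (X : subshift A).
Context (phi : cellular_automaton X) (mu nu : probability X R).
Hypothesis lim_mu : weak_limit (cesaro_mean phi mu) nu.

Lemma Rintegral_indic (P : probability X R) (B : set X) : measurable B ->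
  \int[P]_x \1_B x = fine (P B).
Proof. by move=> mB; rewrite /Rintegral integral_indic// setIT. Qed.

Lemma eq_measure_window_fine (m1 m2 : probability X R) :
  (forall n G, window_set n G -> fine (m1 G) = fine (m2 G)) ->
  forall B : set X, measurable B -> m1 B = m2 B.
Proof.
move=> m12; apply: eq_measure_window => n G wG.
have mG : measurable G by exact: open_measurable_points (window_set_open wG).
have fin (P : probability X R) : P G \is a fin_num by exact: fin_num_measure.
by rewrite -(fineK (fin m1)) (m12 _ _ wG) fineK.
Qed.

Lemma indic_ca_continuous n (G : set X) : window_set n G ->
  continuous (fun x => \1_G (phi x) : R).
Proof.
move=> wG x; apply: (@continuous_comp X X R phi \1_G); first exact: ca_continuous.
exact: window_indic_continuous wG _.
Qed.

(** The Cesaro means of the two sets telescope to a difference of two boundary terms divided by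
    [n]. *)
Lemma weak_limit_ca_invariant n (G : set X) : window_set n G ->
  fine (nu (phi @^-1` G)) = fine (nu G).
Proof.
move=> wG; have bG := window_indic_bounded R wG.
have mG : measurable G by exact: open_measurable_points (window_set_open wG).
have mG' : measurable (phi @^-1` G).
  by rewrite -[X in measurable X]setTI; exact: (@iter_ca_measurable _ _ phi 1%N).
have bG' := iter_ca_bounded_measurable phi 1%N bG.
have G0 x : 0 <= \1_G x :> R by rewrite indicE.
have limG := weak_limit_Rintegral lim_mu (window_indic_continuous wG) bG G0.
have limG' := weak_limit_Rintegral lim_mu (indic_ca_continuous wG) bG' (fun x => G0 (phi x)).
rewrite -(Rintegral_indic nu mG) -(Rintegral_indic nu mG').
pose F i := \int[mu]_x \1_G (iter i phi x) : R.
have F01 i : 0 <= F i <= 1.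
  pose mui : probability X R := distribution mu (ca_iter phi i).
  have -> : F i = fine (mui G).
    by rewrite -(Rintegral_indic mui mG); exact/esym/Rintegral_distribution_ca.
  rewrite fine_ge0//= -lee_fin fineK; last exact: fin_num_measure.
  exact: probability_le1.
have inv0 : (n%:R^-1 : R) @[n --> \oo] --> (0 : R).
  by rewrite -cvg_shiftS; exact: cvg_harmonic.
have diff0 : n%:R^-1 * (F n.+1 - F 1%N) @[n --> \oo] --> (0 : R).
  apply: (@squeeze_cvgr _ _ _ _ (fun n => - (n%:R^-1)) (fun n => n%:R^-1)) => //.
    apply: nearW => k; have k0 : 0 <= k%:R^-1 :> R by rewrite invr_ge0.
    move: (F01 k.+1) (F01 1%N) => /andP[? ?] /andP[? ?].
    by apply/andP; split; [rewrite -[leLHS]mulrN1|rewrite -[leRHS]mulr1]; apply: ler_wpM2l => //; lra.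
  by rewrite -[0]oppr0; exact: cvgN.
have telescope k : \sum_(i < k) F i.+2 - \sum_(i < k) F i.+1 = F k.+1 - F 1%N.
  elim: k => [|k IH]; first by rewrite !big_ord0 !subrr.
  by rewrite !big_ord_recr /=; move: IH; lra.
apply/eqP; rewrite -subr_eq0; apply/eqP; apply: (cvg_unique _ _ diff0) => //.
rewrite /=; under eq_cvg do rewrite -telescope mulrBr.
exact: cvgB limG' limG.
Qed.

End limit_measure.

(** * From an ergodic limit to invariance *)

Section main.
Context (R : realType) (A : finType) (X : subshift A).
Context (phi : cellular_automaton X) (mu nu : probability X R).
Hypotheses (sftX : is_sft X) (irrX : irreducible X) (surj_phi : range phi = [set: X])
  (mu_shift : measure_invariant shift_point mu) (nu_ergodic : shift_ergodic nu)
  (mu_EQ : mu (equicontinuity_points phi) = 1%E)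
  (lim_mu : weak_limit (cesaro_mean phi mu) nu).

Let indic_bounded (B : set X) : measurable B -> bounded_measurable (\1_B : X -> R).
Proof.
move=> mB; split; first exact: measurable_indic.
by exists 1 => x; rewrite indicE; case: (x \in B); rewrite ?normr1 ?normr0.
Qed.

Let periodic m p := [set x | forall i, agree_on_window m x (iter (p * i) phi x)].

(** The period depends on the point. Along factorials the sets [periodic] increase, and they exhaust
    the equicontinuity points because [p] divides its factorial; continuity from below then gives
    one period for all but mass [e]. *)
Let periodic_full m (e : R) : 0 < e ->
  exists2 p, (0 < p)%N & fine (mu (~` periodic m p)) <= e.
Proof.
move=> e0; pose F N := periodic m N`!.
have mF N : measurable (F N) by exact: window_periodic_measurable.
have mUF : measurable (\bigcup_N F N) by exact: bigcupT_measurable.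
have ndF : {homo F : n k / (n <= k)%N >-> (n <= k)%O}.
  move=> n k nk; apply/subsetPset => x xF i.
  by rewrite -(bin_fact nk) mulnCA -!mulnA; exact: xF.
have EQF : equicontinuity_points phi `<=` \bigcup_N F N.
  move=> x /(equicontinuity_periodic m sftX irrX surj_phi)[p p0 xp].
  exists p => // i; have /dvdnP[q ->] : (p %| p`!)%N by rewrite dvdn_fact// p0 leqnn.
  by rewrite mulnAC mulnC; exact: xp.
have UF1 : mu (\bigcup_N F N) = 1%E.
  apply/eqP; rewrite eq_le probability_le1//= -mu_EQ.
  by apply: le_measure; rewrite ?inE//; exact: equicontinuity_points_measurable.
have : mu (F N) @[N --> \oo] --> 1%:E.
  by rewrite -UF1; exact: (nondecreasing_cvg_mu mF mUF ndF).
move=> /fine_cvg /= /cvgrPdist_le/(_ _ e0)[N _ /(_ N (leqnn N))] /= NP.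
exists N`!; first exact: fact_gt0.
rewrite probability_setC; last exact: mF.
rewrite fineB//; last by apply: fin_num_measure; exact: mF.
exact: le_trans (ler_norm _) NP.
Qed.

(* The distribution of [phi^(p i)] stays [e]-close to [mu] on [G], and by shift
   invariance it gives [G] mass at most [nu G + e] plus the mean of [M L / L].
   Summed over [i], these means are at most [p] times Cesaro means, which tend
   to the integral of [M L / L] for [nu]; this vanishes as [L] grows. *)
Let window_le n (G : set X) : window_set n G -> fine (mu G) <= fine (nu G).
Proof.
(* One [e] pays for the points outside [periodic], the other makes the mean of [g] strictly
   negative. *)
move=> wG; apply/ler_addgt0Pr => e' e'0; pose e := e' / 2.
have e0 : 0 < e by rewrite divr_gt0.
have mG : measurable G by exact: open_measurable_points (window_set_open wG).
have [p p0 pe] := periodic_full n e0.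
set c := fine (nu G); set a := fine (mu G).
have mshift := @shift_point_measurable A X.
(* Its integral under [nu] is [-e], as [maxsum_mean_cvg0] demands a negative mean. *)
pose g (x : X) : R := \1_G x - (c + e).
have bG := indic_bounded mG.
have bg : bounded_measurable g.
  by apply: bounded_measurableD => //; exact: bounded_measurable_cst.
have cg : continuous g.
  have sub_cst (T : topologicalType) (f : T -> R) k :
      continuous f -> continuous (fun t => f t - k).
    by move=> cf t; apply: cvgB; [exact: cf|exact: cvg_cst].
  exact: sub_cst (window_indic_continuous wG).
have iG (P : probability X R) : P.-integrable setT (EFin \o (\1_G : X -> R)).
  exact: bounded_measurable_integrable.
have int_g (P : probability X R) : \int[P]_x g x = \int[P]_x \1_G x - (c + e).
  exact: RintegralB_cst.
have g_neg : \int[nu]_x g x < 0.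
  by rewrite int_g Rintegral_indic// -/c; lra.
pose M L := maxsum (shift_point (X := X)) g L.
have bM L : bounded_measurable (M L).
  by exact: maxsum_bounded_measurable.
have M0 L x : 0 <= M L x by exact: maxsum_ge0.
have step i L : (0 < L)%N ->
    a <= c + 2 * e + L%:R^-1 * \int[mu]_x M L (iter (p * i) phi x).
  move=> L0; pose mui : probability X R := distribution mu (ca_iter phi (p * i)).
  have inv_mui B : measurable B -> mui (shift_point @^-1` B) = mui B.
    move=> mB; have mB' : measurable (iter (p * i) phi @^-1` B).
      by rewrite -[X in measurable X]setTI; exact: (@iter_ca_measurable _ _ phi).
    transitivity (mu (shift_point @^-1` (iter (p * i) phi @^-1` B))); last exact: mu_shift mB'.
    congr (mu _); apply/seteqP; split=> x /=;
      by rewrite /ca_iter (iter_ca_shift _ _ 1%N).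
  have := Rintegral_le_maxsum mshift inv_mui bg L.
  rewrite int_g (Rintegral_distribution_ca _ _ _ bG) (Rintegral_distribution_ca _ _ _ (bM L)).
  rewrite -/(M L) => leM.
  (* On [periodic n p] membership in [G] is the same at times 0 and [p i]; the remaining points have
     mass at most [e]. *)
  have le_a : a <= \int[mu]_x \1_G (iter (p * i) phi x) + e.
    have mC := measurableC (window_periodic_measurable phi n p).
    apply: le_trans (lerD (lexx _) pe).
    rewrite /a -(Rintegral_indic mu mG) -(Rintegral_indic mu mC).
    have bGi := iter_ca_bounded_measurable phi (p * i)%N bG.
    have bC := indic_bounded mC.
    rewrite -RintegralD//; [|exact: (bounded_measurable_integrable mu bGi)
      |exact: (bounded_measurable_integrable mu bC)].
    apply: le_Rintegral => //.
    - exact: iG.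
    - exact: (bounded_measurable_integrable mu (bounded_measurableD bGi bC)).
    move=> x _; rewrite !indicE.
    have [xp|xp] := pselect (periodic n p x).
      suff -> : (x \in G) = (iter (p * i) phi x \in G) by rewrite lerDl.
      by apply/idP/idP => /set_mem h; apply/mem_set;
        [exact: wG (xp i) h|exact: wG (agree_sym (xp i)) h].
    rewrite [x \in ~` _]mem_set//; apply: le_trans (_ : 1 <= _); last by rewrite lerDr.
    by rewrite lern1 leq_b1.
  rewrite -lerBlDl -ler_pdivrMl ?invr_gt0 ?ltr0n// invrK.
  apply: le_trans leM; rewrite ler_wpM2l//; move: le_a; lra.
have bound L : (0 < L)%N -> a <= c + 2 * e + p%:R * (L%:R^-1 * \int[nu]_x M L x).
  move=> L0; have limM := weak_limit_Rintegral lim_mu (maxsum_continuous cg) (bM L) (M0 L).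
  rewrite -lerBlDl mulrA; apply: (le_cvg_multiples p0 limM) => k k0.
  have sum_step : k%:R * (a - (c + 2 * e)) <=
      L%:R^-1 * \sum_(i < k) \int[mu]_x M L (iter (p * i.+1) phi x).
    rewrite mulr_sumr -[k in k%:R]card_ord mulr_natl -sumr_const; apply: ler_sum => i _.
    by rewrite lerBlDl; exact: step.
  pose F i := \int[mu]_x M L (iter i phi x).
  have F0 i : 0 <= F i by apply: Rintegral_ge0 => x _; exact: M0.
  have sumF := sum_multiples_le k p0 F0.
  set S := \sum_(i < p * k) F i.+1 in sumF *.
  have -> : p%:R * L%:R^-1 * ((p * k)%N%:R^-1 * S) = k%:R^-1 * (L%:R^-1 * S).
    rewrite natrM; field.
    by rewrite !pnatr_eq0 -!lt0n L0 p0 k0.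
  rewrite ler_pdivlMl ?ltr0n//; apply: le_trans sum_step _.
  by rewrite ler_wpM2l ?invr_ge0.
apply/ler_addgt0Pr => d d0.
(* Here [p] is already fixed, so a large [L] absorbs it. *)
have := maxsum_mean_cvg0 mshift (proj1 nu_ergodic) bg (proj2 nu_ergodic) g_neg.
move=> /cvgrPdist_le/(_ (d / p%:R))[|L0 _ LP]; first by rewrite divr_gt0 ?ltr0n.
have := LP L0.+1 (leqnSn _); rewrite sub0r normrN => /(le_trans (ler_norm _)) Ld.
have := bound L0.+1 isT.
have : p%:R * (L0.+1%:R^-1 * \int[nu]_x M L0.+1 x) <= d.
  by rewrite -ler_pdivlMl ?ltr0n// [_ * d]mulrC.
have -> : 2 * e = e' by rewrite /e mulrC divfK.
by move=> Yd /le_trans; apply; rewrite lerD2l.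
Qed.

(** The reverse inequality is [window_le] for the complement, both measures having mass 1. *)
Let window_eq n (G : set X) : window_set n G -> fine (mu G) = fine (nu G).
Proof.
move=> wG; have mG : measurable G by exact: open_measurable_points (window_set_open wG).
apply/eqP; rewrite eq_le (window_le wG) /=; have := window_le (window_setC wG).
rewrite !probability_setC// !fineB//=; try exact: fin_num_measure.
by rewrite lerD2l lerN2.
Qed.

Lemma ergodic_limit_invariant : measure_invariant phi mu.
Proof.
pose mu1 : probability X R := distribution mu (ca_iter phi 1%N).
apply: (eq_measure_window_fine (m1 := mu1) (m2 := mu)) => n G wG.
have mG : measurable G by exact: open_measurable_points (window_set_open wG).
have mG' : measurable (phi @^-1` G).
  by rewrite -[X in measurable X]setTI; exact: (@iter_ca_measurable _ _ phi 1%N).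
rewrite (window_eq wG) -(weak_limit_ca_invariant lim_mu wG).
exact: (congr1 fine (eq_measure_window_fine window_eq mG')).
Qed.

End main.

(** * The converse and the equivalence *)

Lemma invariant_limit (R : realType) (A : finType) (X : subshift A)
    (phi : cellular_automaton X) (mu nu : probability X R) :
  weak_limit (cesaro_mean phi mu) nu -> measure_invariant phi mu ->
  forall B, measurable B -> nu B = mu B.
Proof.
move=> lim_mu inv; apply: eq_measure_window_fine => n G wG.
have mG : measurable G by exact: open_measurable_points (window_set_open wG).
have bG := window_indic_bounded R wG.
have G0 x : 0 <= \1_G x :> R by rewrite indicE.
have limG := weak_limit_Rintegral lim_mu (window_indic_continuous wG) bG G0.
rewrite -!Rintegral_indic//; apply: (cvg_unique _ limG) => //.
have inv_i i : \int[mu]_x \1_G (iter i phi x) = \int[mu]_x \1_G x.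
  elim: i => [//|i <-].
  under eq_Rintegral do rewrite iterSr.
  exact: (Rintegral_invariant (@iter_ca_measurable _ _ phi 1%N) inv
    (iter_ca_bounded_measurable phi i bG)).
have inv_S i : \int[mu]_x \1_G (phi (iter i phi x)) = \int[mu]_x \1_G x := inv_i i.+1.
rewrite /=; under eq_cvg do under eq_bigr do rewrite inv_S.
(* The means are constant from [n = 1] on; at [n = 0] the formula gives 0. *)
apply: cvg_near_cst; exists 1%N => // k /= k0.
by rewrite sumr_const card_ord -[X in _ * X]mulr_natl mulKf// pnatr_eq0 -lt0n.
Qed.

Theorem theorem3p15 (R : realType) (A : finType) (X : subshift A)
    (phi : cellular_automaton X) (mu mu_oo : probability X R)
    (sftX : is_sft X) (irrX : irreducible X)
    (surj_phi : range phi = [set: X])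
    (ergodic_mu : shift_ergodic mu)
    (mu_EQ : mu (equicontinuity_points phi) = 1%E)
    (lim_mu : weak_limit (cesaro_mean phi mu) mu_oo) :
  shift_ergodic mu_oo <-> measure_invariant phi mu.
Proof.
split=> [erg|inv].
  exact: ergodic_limit_invariant sftX irrX surj_phi (proj1 ergodic_mu) erg mu_EQ lim_mu.
have eq_mu := invariant_limit lim_mu inv.
have [inv_mu erg_mu] := ergodic_mu; split=> [B mB|B mB BB].
  have mB' : measurable (shift_point @^-1` B).
    by rewrite -[X in measurable X]setTI; exact: (@shift_point_measurable A X).
  by rewrite /pushforward eq_mu// eq_mu//; exact: inv_mu.
by rewrite eq_mu//; exact: erg_mu.
Qed.
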